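(* Let $X$ be a (real) Banach space with enough Pettis integrals. Then $X$ is an $\mathbb{M}$-algebra when we endow $X$ with the weak sigma-algebra, the norm bornology, and the structure map $c:MX\to X$ sending each $\mu\in MX$ to the Pettis integral of the identity map $\mathrm{id}_X:X\to X$ with respect to $\mu$.
   Context: Pettis integrals. For a real Banach space $X$, $X^*$ is the space of bounded linear functionals on $X$; the weak sigma-algebra on $X$ is the one generated by all $\varphi\in X^*$; the norm bornology consists of the norm-bounded subsets. For a measurable space $T$, $f:T\to X$ is weakly measurable if $\varphi\circ f$ is measurable for all $\varphi\in X^*$. Given a weakly measurable $f:T\to X$ and a finite signed measure $\mu$ on $T$, a vector $x\in X$ is a Pettis integral of $f$ with respect to $\mu$ if for all $\varphi\in X^*$, $\varphi\circ f$ is $\mu$-integrable (i.e. integrable with respect to $|\mu|$) and $\varphi(x)=\int\varphi\circ f\,d\mu$; it is unique if it exists. $X$ has enough Pettis integrals if for every measurable space $T$, every weakly measurable $f:T\to X$ with bounded image, and every finite signed measure $\mu$ on $T$, a Pettis integral of $f$ with respect to $\mu$ exists in $X$. A bornology on a set $X$ is a collection of subsets of $X$ (the bounded subsets) closed under taking subsets and finite unions (in particular containing $\emptyset$) and containing all singletons. A measurable bornological set is a set equipped with both a bornology and a sigma-algebra; $\mathbf{BornMeas}$ is the category of these with maps that are measurable and bornological (images of bounded sets are bounded). $\mathbb{R}$ carries its Borel sigma-algebra and usual bornology. A subset $A\subseteq X$ carries the sigma-algebra $\{A\cap E\mid E\subseteq X\text{ measurable}\}$ and the bornology of those subsets of $A$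 bounded in $X$. For a measurable space $X$, $SX$ is the real vector space of all finite signed measures on $X$, with the sigma-algebra generated by the evaluation maps $\mathrm{Ev}_E:\mu\mapsto\mu(E)$ ($E$ measurable) and the total variation norm $\|\mu\|=|\mu|(X)$. For $f:X\to Y$ measurable, $Sf(\mu)$ is the direct image measure $F\mapsto\mu(f^{-1}(F))$. $\mu\in SX$ is supported by an arbitrary subset $A\subseteq X$ if it is the direct image, along the inclusion $A\hookrightarrow X$, of some measure in $SA$. The monad $\mathbb{M}=(M,\delta,\kappa)$ on $\mathbf{BornMeas}$: $MX$ is the set of all $\mu\in SX$ supported by some bounded $B\subseteq X$, with sigma-algebra generated by the maps $\mathrm{Ev}_E:MX\to\mathbb{R}$ and bornology consisting of all subsets of the sets $M(B,X,\gamma)=\{\mu\in MX\mid\mu\text{ supported by }B,\ \|\mu\|\leqslant\gamma\}$ ($B\subseteq X$ bounded, $\gamma\geqslant0$); $Mf$ is the restriction of $Sf$; $\delta_X(x)=\delta_x$ is the Dirac measure; $(\kappa_X(\mathcal{M}))(E)=\int\mathrm{Ev}_E\,d\mathcal{M}$ for $\mathcal{M}\in MMX$. An $\mathbb{M}$-algebra is $X\in\mathbf{BornMeas}$ with a $\mathbf{BornMeas}$-morphism $c:MX\to X$ such that $c\circ\delta_X=1_X$ and $c\circ Mc=c\circ\kappa_X$. *)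

(* Defs.v *)
From HB Require Import structures.
From mathcomp Require Import all_boot all_order all_algebra.
From mathcomp Require Import all_classical all_reals all_analysis.
From mathcomp Require Import measurable_realfun.

Set Implicit Arguments.
Unset Strict Implicit.
Unset Printing Implicit Defensive.

Import Order.TTheory GRing.Theory Num.Theory.
Import numFieldNormedType.Exports.

Local Open Scope classical_set_scope.
Local Open Scope ring_scope.

Section charge_integration.
Context d (T : measurableType d) (R : realType).
Implicit Types (nu : {charge set T -> \bar R}) (f : T -> R).

(* A Hahn decomposition chosen once and for all; the Jordan decomposition, and
   hence everything below, does not depend on the choice. *)
Definition hahn_pos nu : set T := sval (cid (Hahn_decomposition nu)).

Definition hahn_neg nu : set T :=
  sval (cid (svalP (cid (Hahn_decomposition nu)))).

Lemma hahnPN nu : hahn_decomposition nu (hahn_pos nu) (hahn_neg nu).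
Proof. exact: svalP (cid (svalP (cid (Hahn_decomposition nu)))). Qed.

Definition tv_norm nu : R := fine (charge_variation (hahnPN nu) [set: T]).

Definition charge_integrable nu f : Prop :=
  (charge_variation (hahnPN nu)).-integrable [set: T] (EFin \o f).

Definition charge_integral nu f : R :=
  \int[jordan_pos (hahnPN nu)]_x f x - \int[jordan_neg (hahnPN nu)]_x f x.

Lemma tv_normE nu : (tv_norm nu)%:E =
  (jordan_pos (hahnPN nu) setT + jordan_neg (hahnPN nu) setT)%E.
Proof. by rewrite /tv_norm fineK// fin_num_measure. Qed.

Lemma charge_le_tv_norm nu (E : set T) : measurable E ->
  (`|nu E| <= (tv_norm nu)%:E)%E.
Proof.
move=> mE; rewrite (jordan_decomp (hahnPN nu) mE) tv_normE /cadd/= cscaleN1.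
rewrite (le_trans (lee_abs_sub _ _))// !gee0_abs ?measure_ge0//.
by apply: leeD; apply: le_measure => //; rewrite inE.
Qed.

End charge_integration.

(* A charge is a function on all subsets of [T]; requiring that it vanishes on
   the non-measurable ones makes [=] mean equality on measurable sets. *)
Record smeasure d (T : measurableType d) (R : realType) := SMeasure {
  smeasure_charge :> {charge set T -> \bar R} ;
  smeasure_out : forall E, ~ measurable E -> smeasure_charge E = 0%E }.

Definition Ev d (T : measurableType d) (R : realType) (E : set T)
  (mu : smeasure T R) : R := fine (mu E).

Section smeasure_of.
Context d (T : measurableType d) (R : realType).
Variable nu : {charge set T -> \bar R}.

Let crestr0_out (E : set T) : ~ measurable E -> crestr0 nu measurableT E = 0%E.
Proof. by move=> nE; rewrite /crestr0 memNset. Qed.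

Definition smeasure_of : smeasure T R := SMeasure crestr0_out.

Lemma smeasure_ofE (E : set T) : measurable E -> smeasure_of E = nu E.
Proof. by move=> mE /=; rewrite /crestr0 mem_set// /crestr setIT. Qed.

End smeasure_of.

Definition smeasure0 d (T : measurableType d) (R : realType) : smeasure T R :=
  smeasure_of (@czero _ T R).

(* The charge structure of [pushforward mu f] is named explicitly because its
   measurability argument cannot be inferred. *)
Definition smeasure_map d1 d2 (T1 : measurableType d1) (T2 : measurableType d2)
    (R : realType) (f : T1 -> T2) (mf : measurable_fun [set: T1] f)
    (mu : smeasure T1 R) : smeasure T2 R :=
  smeasure_of (measure_function_pushforward__canonical__charge_Charge mu mf).

Lemma smeasure_mapE d1 d2 (T1 : measurableType d1) (T2 : measurableType d2)
    (R : realType) (f : T1 -> T2) (mf : measurable_fun [set: T1] f)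
    (mu : smeasure T1 R) (E : set T2) : measurable E ->
  smeasure_map mf mu E = mu (f @^-1` E).
Proof. by move=> mE; rewrite smeasure_ofE. Qed.

Definition smeasure_dirac d (T : measurableType d) (R : realType) (x : T) :
    smeasure T R :=
  smeasure_of (charge_of_finite_measure (\d_x : {finite_measure set T -> \bar R})).

(* A [measurableType] is pointed, so the subspace carried by a possibly empty
   subset is not one; finite signed measures on it are spelled out here, with
   the clauses of [isCharge], on an explicit sigma-algebra [Sigma]. *)
Definition is_signed_measure (R : realType) (S : Type) (Sigma : set_system S)
    (nu : set S -> \bar R) : Prop :=
  [/\ nu set0 = 0%E,
      (forall E, Sigma E -> nu E \is a fin_num) &
      (forall F : (set S)^nat, (forall n, Sigma (F n)) -> trivIset setT F ->
        (fun n => (\sum_(0 <= i < n) nu (F i))%E) @ \oo --> nu (\bigcup_n F n))].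

Definition trace_sigma d (T : measurableType d) (A : set T) : set_system A :=
  preimage_set_system [set: A] set_val measurable.

Definition supported_by d (T : measurableType d) (R : realType) (A : set T)
    (mu : smeasure T R) : Prop :=
  exists2 nu : set A -> \bar R, is_signed_measure (@trace_sigma _ T A) nu &
    forall E, measurable E -> mu E = nu (set_val @^-1` E).

Section support.
Context d (T : measurableType d) (R : realType).
Implicit Types (A B : set T) (mu : smeasure T R).

Lemma supported_by0 A mu (E : set T) : supported_by A mu ->
  measurable E -> E `&` A = set0 -> mu E = 0%E.
Proof.
move=> [nu [nu0 _ _] muE] mE EA; rewrite muE// (_ : _ @^-1` _ = set0)//.
rewrite -subset0 => x /= Ex; rewrite -[False]/(set0 (set_val x)) -EA; split => //.
exact: set_valP.
Qed.

Lemma supported_byP A mu : supported_by A mu <->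
  forall E, measurable E -> E `&` A = set0 -> mu E = 0%E.
Proof.
split=> [sA E|H]; first exact: supported_by0.
pose ext (F : set A) := xget set0 [set E | measurable E /\ set_val @^-1` E = F].
have extP F : trace_sigma F -> measurable (ext F) /\ set_val @^-1` (ext F) = F.
  move=> [E mE <-]; rewrite setTI.
  exact: (@xgetPex _ set0 [set E0 | measurable E0 /\ set_val @^-1` E0 = set_val @^-1` E] (ex_intro _ E (conj mE erefl))).
have wd (E E' : set T) : measurable E -> measurable E' ->
    set_val @^-1` E = set_val @^-1` E' :> set A -> mu E = mu E'.
  have half (E1 E2 : set T) : measurable E1 -> measurable E2 ->
      set_val @^-1` E1 = set_val @^-1` E2 :> set A -> mu E1 = mu (E1 `&` E2).
    move=> m1 m2 e12.
    have D0 : mu (E1 `\` E2) = 0%E.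
      apply: H; first exact: measurableD.
      rewrite -subset0 => x [[E1x nE2x] Ax]; apply: nE2x.
      have /= := congr1 (fun F => F (SigSub (mem_set Ax) : A)) e12.
      by rewrite /preimage/= => <-.
    have mI : measurable (E1 `&` E2) by exact: measurableI.
    have mD : measurable (E1 `\` E2) by exact: measurableD.
    rewrite -[in LHS](setUIDK E1 E2) chargeU// ?D0 ?adde0//.
    by rewrite setDE setIACA setICr setI0.
  by move=> mE mE' e; rewrite (half E E')// (half E' E)// setIC.
exists (fun F => mu (ext F)).
  split.
  - have [m0 e0] : measurable (ext set0) /\ set_val @^-1` ext set0 = set0 :> set A.
      by apply: extP; exists set0 => //; rewrite preimage_set0 setI0.
    by rewrite (wd _ _ m0 measurable0 e0) charge0.
  - by move=> F /extP[mF _]; exact: fin_num_measure.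
  - move=> F tF trF.
    have mext n : measurable (ext (F n)) by have [] := extP _ (tF n).
    have vext n : set_val @^-1` (ext (F n)) = F n by have [] := extP _ (tF n).
    pose G := seqDU (fun n => ext (F n)).
    have mG n : measurable (G n).
      apply: measurableD => //; exact: bigsetU_measurable.
    have vG n : set_val @^-1` (G n) = F n.
      have extE k x : ext (F k) (set_val x) = F k x.
        by have := congr1 (fun C : set A => C x) (vext k).
      apply/seteqP; split=> x; rewrite /G /seqDU /preimage/=.
        by move=> [+ _]; rewrite extE.
      move=> Fnx; split; first by rewrite extE.
      rewrite -bigcup_seq => -[k _]; rewrite extE => Fkx.
      move/trivIsetP : trF => /(_ k n Logic.I Logic.I).
      rewrite (ltn_eqF (ltn_ord k)) => /(_ isT) Fkn0.
      by rewrite -[False]/((set0 : set A) x) -Fkn0.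
    have -> : mu (ext (\bigcup_n F n)) = mu (\bigcup_n G n).
      have [] : measurable (ext (\bigcup_n F n)) /\
          set_val @^-1` (ext (\bigcup_n F n)) = \bigcup_n F n.
        apply: extP; exists (\bigcup_n G n); first exact: bigcupT_measurable.
        by rewrite setTI preimage_bigcup; apply: eq_bigcupr => n _; exact: vG.
      move=> m1 e1; apply: wd => //; first exact: bigcupT_measurable.
      by rewrite e1 preimage_bigcup; apply: eq_bigcupr => n _; rewrite vG.
    under eq_fun do under eq_bigr do rewrite (wd _ (G _) (mext _) (mG _) (etrans (vext _) (esym (vG _)))).
    apply: charge_semi_sigma_additive => //; first exact: trivIset_seqDU.
    exact: bigcupT_measurable.
move=> E mE; have [m1 e1] : measurable (ext (set_val @^-1` E)) /\
    set_val @^-1` (ext (set_val @^-1` E)) = set_val @^-1` E :> set A.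
  by apply: extP; exists E => //; rewrite setTI.
exact: wd.
Qed.

Lemma supported_byS A B mu : A `<=` B -> supported_by A mu -> supported_by B mu.
Proof.
move=> AB /supported_byP sA; apply/supported_byP => E mE EB; apply: sA => //.
by apply/seteqP; split=> // x [Ex /AB Bx]; rewrite -EB.
Qed.

End support.

HB.mixin Record isBornological T := {
  born : set_system T ;
  born0 : born set0 ;
  born_sub : forall A B, A `<=` B -> born B -> born A ;
  bornU : forall A B, born A -> born B -> born (A `|` B) ;
  born1 : forall x, born [set x] }.

#[short(type="bornologicalType")]
HB.structure Definition Bornological := {T of isBornological T}.

#[short(type="bornMeasType")]
HB.structure Definition BornMeas d := {T of Measurable d T & Bornological T}.

Definition bornMeas_morphism d1 d2 (X : bornMeasType d1) (Y : bornMeasType d2)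
    (f : X -> Y) : Prop :=
  measurable_fun [set: X] f /\ forall B : set X, born B -> born (f @` B).

Record Mspace (R : realType) d (X : bornMeasType d) := MSpace {
  Mspace_smeasure :> smeasure X R ;
  Mspace_supported : exists2 B, born B & supported_by B Mspace_smeasure }.

Section Mspace_structure.
Context (R : realType) d (X : bornMeasType d).
Local Notation MX := (Mspace R X).

Definition Mspace_generators : set_system MX :=
  \bigcup_(E in [set E : set X | measurable E])
    preimage_set_system [set: MX] (fun mu : MX => Ev E mu) measurable.

Definition Mball (B : set X) (g : R) : set MX :=
  [set mu : MX | supported_by B mu /\ tv_norm mu <= g].

Definition Mborn : set_system MX :=
  [set A | exists B g, [/\ born B, 0 <= g & A `<=` Mball B g]].

Lemma supported_by_smeasure0 : supported_by set0 (smeasure0 X R).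
Proof. by apply/supported_byP => E mE _; rewrite smeasure_ofE. Qed.

Definition Mspace0 : MX :=
  MSpace (ex_intro2 _ _ set0 born0 supported_by_smeasure0).

HB.instance Definition _ := gen_eqMixin MX.
HB.instance Definition _ := gen_choiceMixin MX.
HB.instance Definition _ := isPointed.Build MX Mspace0.
HB.instance Definition _ := @isMeasurable.Build (sigma_display Mspace_generators)
  MX <<s Mspace_generators >> (@sigma_algebra0 _ _ _)
  (@sigma_algebraC _ _)
  (@sigma_algebra_bigcup _ _ _).

Let Mborn0 : Mborn set0.
Proof. by exists set0, 0; split=> //; exact: born0. Qed.

Let Mborn_sub A B : A `<=` B -> Mborn B -> Mborn A.
Proof.
move=> AB [C [g [bC g0 BC]]]; exists C, g; split=> //.
exact: subset_trans BC.
Qed.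

Let MbornU A B : Mborn A -> Mborn B -> Mborn (A `|` B).
Proof.
move=> [C [g [bC g0 AC]]] [C' [g' [bC' g0' BC']]].
exists (C `|` C'), (Num.max g g'); split; first exact: bornU.
  by rewrite le_max g0.
move=> mu [/AC|/BC'] [smu nmu]; split.
- exact: supported_byS smu.
- by rewrite le_max nmu.
- exact: supported_byS smu.
- by rewrite le_max nmu orbT.
Qed.

Let Mborn1 (mu : MX) : Mborn [set mu].
Proof.
have [B bB sB] := Mspace_supported mu; exists B, (tv_norm mu); split=> //.
- by rewrite fine_ge0.
- by move=> _ ->; split.
Qed.

HB.instance Definition _ :=
  isBornological.Build MX Mborn0 Mborn_sub MbornU Mborn1.

Lemma measurable_Ev (E : set X) : measurable E ->
  measurable_fun [set: MX] (fun mu : MX => Ev E mu).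
Proof.
move=> mE _ B mB; apply: sub_gen_smallest; exists E => //.
by exists B.
Qed.

End Mspace_structure.

Section Mfun.
Context (R : realType) d1 d2 (X : bornMeasType d1) (Y : bornMeasType d2).
Variables (f : X -> Y) (hf : bornMeas_morphism f).

Lemma Mfun_supported (mu : Mspace R X) :
  exists2 B, born B & supported_by B (smeasure_map hf.1 mu).
Proof.
have [B bB sB] := Mspace_supported mu; exists (f @` B); first exact: hf.2.
apply/supported_byP => E mE EfB; rewrite smeasure_mapE//.
apply: (supported_by0 sB).
  by rewrite -[X in measurable X]setTI; exact: hf.1.
rewrite -subset0 => x [Efx Bx].
by have : (set0 : set Y) (f x) by rewrite -EfB; split => //; exists x.
Qed.

Definition Mfun (mu : Mspace R X) : Mspace R Y := MSpace (Mfun_supported mu).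

End Mfun.

Section Munit.
Context (R : realType) d (X : bornMeasType d).

Lemma Munit_supported (x : X) :
  exists2 B, born B & supported_by B (smeasure_dirac R x).
Proof.
exists [set x]; first exact: born1.
apply/supported_byP => E mE Ex; rewrite smeasure_ofE//.
rewrite [LHS](@diracE _ X R x E) memNset// => E_x.
by have : (set0 : set X) x by rewrite -Ex; split.
Qed.

Definition Munit (x : X) : Mspace R X := MSpace (Munit_supported x).

End Munit.
Arguments Munit R {d X} x.

Section dominated_off_null.
Context d (T : measurableType d) (R : realType).
Variables (m : {finite_measure set T -> \bar R}) (D : set T) (g : R).
Hypothesis mD0 : forall U, measurable U -> U `&` D = set0 -> m U = 0%E.

Lemma Rintegral_cvg_off_null (f_ : (T -> R)^nat) (f : T -> R) :
  (forall n, measurable_fun [set: T] (f_ n)) -> measurable_fun [set: T] f ->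
  (forall x, f_ ^~ x @ \oo --> f x) ->
  (forall n x, D x -> `|f_ n x| <= g) ->
  m.-integrable [set: T] (EFin \o f) /\
  (fun n => \int[m]_x f_ n x) @ \oo --> \int[m]_x f x.
Proof.
move=> mf_ mf cf bf.
pose N := \bigcup_n ((fun x => `|f_ n x|) @^-1` `]g, +oo[%classic).
have mN : measurable N.
  apply: bigcupT_measurable => n; rewrite -[X in measurable X]setTI.
  have mn : measurable_fun setT (fun x => `|f_ n x|) by exact: measurableT_comp.
  by apply: mn => //; exact: measurable_itv.
have N0 : m N = 0%E.
  apply: mD0 => //; rewrite -subset0 => x [[n _ /=]].
  by rewrite in_itv/= andbT ltNge => /negP fng /(bf n)/fng.
have [] := @dominated_convergence _ T R m [set: T] measurableT
  (fun n => EFin \o f_ n) (EFin \o f) (cst g%:E).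
- by move=> n; exact: measurableT_comp.
- exact: measurableT_comp.
- by apply: aeW => x _; apply: cvg_EFin; [exact: nearW|exact: cf].
- exact: finite_measure_integrable_cst.
- exists N; split=> // x /= nx; apply: contrapT => Nx; apply: nx => n _.
  rewrite lee_fin leNgt; apply/negP => gx; apply: Nx; exists n => //=.
  by rewrite in_itv/= gx.
- move=> intf _ cvi; split=> //; apply: fine_cvg.
  by rewrite fineK//; exact: integrable_fin_num.
Qed.

Lemma integrable_off_null (f : T -> R) : measurable_fun [set: T] f ->
  (forall x, D x -> `|f x| <= g) -> m.-integrable [set: T] (EFin \o f).
Proof.
move=> mf bf.
have [//|//|x|//|//] := @Rintegral_cvg_off_null (fun=> f) f.
exact: cvg_cst.
Qed.

Lemma Rintegral_off_null (f : T -> R) : measurable_fun [set: T] f ->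
  (forall x, D x -> f x = 0) -> \int[m]_x f x = 0.
Proof.
move=> mf f0; rewrite /Rintegral (@ae_eq_integral _ _ _ m setT (cst 0%E))//.
- by rewrite integral0.
- exact: measurableT_comp.
exists (f @^-1` ~` [set 0]); split.
- by rewrite -[X in measurable X]setTI; apply: mf => //; exact: measurableC.
- apply: mD0.
    by rewrite -[X in measurable X]setTI; apply: mf => //; exact: measurableC.
  by rewrite -subset0 => x [/= nf Dx]; apply: nf; exact: f0.
- by move=> x /= nx fx; apply: nx => _; rewrite fx.
Qed.

End dominated_off_null.

Section Mmult.
Context (R : realType) d (X : bornMeasType d).
Variable M : Mspace R (Mspace R X).
Local Notation MX := (Mspace R X).

Definition Mmult_fun (E : set X) : \bar R :=
  (charge_integral M (fun mu : MX => Ev E mu))%:E.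

Lemma Ev_le (mu : MX) (E : set X) : measurable E -> `|Ev E mu| <= tv_norm mu.
Proof.
move=> mE; have muE : mu E \is a fin_num by exact: fin_num_measure.
rewrite -lee_fin (le_trans _ (charge_le_tv_norm mu mE))//.
by rewrite -[in leRHS](fineK muE) abse_EFin.
Qed.

Lemma EvU (mu : MX) (E F : set X) : measurable E -> measurable F ->
  E `&` F = set0 -> Ev (E `|` F) mu = Ev E mu + Ev F mu.
Proof.
by move=> mE mF EF; rewrite /Ev chargeU// fineD//; exact: fin_num_measure.
Qed.

Let jordan_null (D : set MX) : supported_by D M -> forall U, measurable U ->
  U `&` D = set0 ->
  jordan_pos (hahnPN M) U = 0%E /\ jordan_neg (hahnPN M) U = 0%E.
Proof.
move=> sD U mU UD; have [[mP _] [mN _] _ _] := hahnPN M.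
have sub0 V : (U `&` V) `&` D = set0 by rewrite setIAC UD set0I.
rewrite jordan_posE cjordan_posE jordan_negE cjordan_negE /crestr0 mem_set//.
by rewrite /crestr !(supported_by0 sD (measurableI _ _ mU _) (sub0 _))// oppe0.
Qed.

Let supp : exists B g, exists2 D, supported_by D M &
  forall mu : MX, D mu -> supported_by B mu /\ tv_norm mu <= g.
Proof. by have [D [B [g [_ _ DB]]] sD] := Mspace_supported M; exists B, g, D. Qed.

Let Mmult_cvg (f_ : (MX -> R)^nat) (f : MX -> R) :
  (forall n, measurable_fun [set: MX] (f_ n)) -> measurable_fun [set: MX] f ->
  (forall mu, f_ ^~ mu @ \oo --> f mu) ->
  (forall n mu, `|f_ n mu| <= tv_norm mu) ->
  (fun n => charge_integral M (f_ n)) @ \oo --> charge_integral M f.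
Proof.
move=> mf_ mf cf bf; have [B [g [D sD DB]]] := supp.
have bD n mu : D mu -> `|f_ n mu| <= g.
  by move=> /DB[_]; exact: le_trans.
apply: cvgB.
- by have [] := @Rintegral_cvg_off_null _ _ _ (jordan_pos (hahnPN M)) D g
    (fun U mU UD => (jordan_null sD mU UD).1) f_ f mf_ mf cf bD.
- by have [] := @Rintegral_cvg_off_null _ _ _ (jordan_neg (hahnPN M)) D g
    (fun U mU UD => (jordan_null sD mU UD).2) f_ f mf_ mf cf bD.
Qed.

Let Mmult_integrable (E : set X) : measurable E ->
  (jordan_pos (hahnPN M)).-integrable [set: MX] (EFin \o (fun mu : MX => Ev E mu)) /\
  (jordan_neg (hahnPN M)).-integrable [set: MX] (EFin \o (fun mu : MX => Ev E mu)).
Proof.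
move=> mE; have [B [g [D sD DB]]] := supp.
have bD mu : D mu -> `|Ev E mu| <= g.
  by move=> /DB[_]; apply: le_trans; exact: Ev_le.
split; apply: (@integrable_off_null _ _ _ _ D g) => //.
- by move=> U mU UD; exact: (jordan_null sD mU UD).1.
- exact: measurable_Ev.
- by move=> U mU UD; exact: (jordan_null sD mU UD).2.
- exact: measurable_Ev.
Qed.

Let Mmult_funU (E F : set X) : measurable E -> measurable F ->
  E `&` F = set0 -> Mmult_fun (E `|` F) = (Mmult_fun E + Mmult_fun F)%E.
Proof.
move=> mE mF EF; rewrite /Mmult_fun -EFinD; congr EFin.
rewrite /charge_integral; under eq_Rintegral do rewrite EvU//.
under [X in _ - X]eq_Rintegral do rewrite EvU//.
have [iE1 iE2] := Mmult_integrable mE; have [iF1 iF2] := Mmult_integrable mF.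
by rewrite !RintegralD// opprD addrACA.
Qed.

Let Mmult_fun0 : Mmult_fun set0 = 0%E.
Proof.
rewrite /Mmult_fun /charge_integral /Ev.
under eq_Rintegral do rewrite charge0 /=.
under [X in _ - X]eq_Rintegral do rewrite charge0 /=.
by rewrite !Rintegral_cst// !mul0r subrr.
Qed.

Let Mmult_fun_fin E : measurable E -> Mmult_fun E \is a fin_num.
Proof. by []. Qed.

Let Mmult_fun_sigma_additive : semi_sigma_additive Mmult_fun.
Proof.
move=> F mF tF mUF; pose A n := \big[setU/set0]_(0 <= i < n) F i.
have mA n : measurable (A n) by exact: bigsetU_measurable.
have AS n : A n.+1 = A n `|` F n by rewrite /A big_nat_recr.
have AF n : A n `&` F n = set0.
  rewrite -subset0 => x [].
  rewrite /A big_mkord -bigcup_seq => -[k _ Fkx] Fnx.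
  move/trivIsetP : tF => /(_ k n Logic.I Logic.I).
  rewrite (ltn_eqF (ltn_ord k)) => /(_ isT) Fkn0.
  by have : (set0 : set X) x by rewrite -Fkn0.
have -> : (fun n => \sum_(0 <= i < n) Mmult_fun (F i))%E = Mmult_fun \o A.
  apply/funext => n /=; elim: n => [|n ih]; first by rewrite /A !big_nil.
  by rewrite big_nat_recr//= ih AS Mmult_funU.
apply: cvg_EFin; first exact: nearW.
apply: Mmult_cvg => //.
- by move=> n; exact: measurable_Ev.
- exact: measurable_Ev.
- move=> mu; apply: fine_cvg; rewrite fineK; last exact: fin_num_measure.
  rewrite (_ : (fun n => _) = (fun n => \sum_(0 <= i < n) mu (F i))%E).
    exact: charge_semi_sigma_additive.
  apply/funext => n /=; elim: n => [|n ih].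
    by rewrite /A !big_nil charge0.
  by rewrite AS chargeU// ih big_nat_recr.
- by move=> n mu; exact: Ev_le.
Qed.

HB.instance Definition _ := isCharge.Build _ X R Mmult_fun
  Mmult_fun0 Mmult_fun_fin Mmult_fun_sigma_additive.

Lemma Mmult_supported :
  exists2 B, born B & supported_by B (smeasure_of Mmult_fun).
Proof.
have [D [B [g [bB _ DB]]] sD] := Mspace_supported M; exists B => //.
apply/supported_byP => E mE EB; rewrite smeasure_ofE//.
have D0 mu : D mu -> Ev E mu = 0.
  by move=> /DB[sB _]; rewrite /Ev (supported_by0 sB).
have J := jordan_null sD.
have mEv := @measurable_Ev R _ X E mE.
have jp : \int[jordan_pos (hahnPN M)]_mu Ev E mu = 0 :=
  Rintegral_off_null (fun U mU UD => (J U mU UD).1) mEv D0.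
have jn : \int[jordan_neg (hahnPN M)]_mu Ev E mu = 0 :=
  Rintegral_off_null (fun U mU UD => (J U mU UD).2) mEv D0.
rewrite /Mmult_fun; congr EFin; rewrite -[RHS](subrr 0).
exact: (congr2 (fun a b => a - b) jp jn).
Qed.

Definition Mmult : Mspace R X := MSpace Mmult_supported.

Lemma MmultE (E : set X) : measurable E ->
  Mmult E = (charge_integral M (fun mu : MX => Ev E mu))%:E.
Proof. by move=> mE; rewrite [LHS]smeasure_ofE. Qed.

End Mmult.

Record is_Malgebra (R : realType) d (X : bornMeasType d) (c : Mspace R X -> X) :
    Prop := IsMalgebra {
  Malgebra_morphism : bornMeas_morphism c ;
  Malgebra_unit : c \o Munit R = id ;
  Malgebra_assoc : c \o Mfun Malgebra_morphism = c \o @Mmult R d X }.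

Section pettis.
Context (R : realType) (X : normedModType R).

Definition dual : set {scalar X} :=
  [set phi | exists C : R, forall x, `|phi x| <= C * `|x|].

Definition weakly_measurable d (T : measurableType d) (f : T -> X) : Prop :=
  forall phi, dual phi -> measurable_fun [set: T] (fun t => phi (f t)).

Definition is_pettis_integral d (T : measurableType d) (mu : smeasure T R)
    (f : T -> X) (x : X) : Prop :=
  forall phi, dual phi -> charge_integrable mu (fun t => phi (f t)) /\
    phi x = charge_integral mu (fun t => phi (f t)).

(* [T] ranges over the nonempty measurable spaces; over the empty one, [0] is
   always a Pettis integral. *)
Definition enough_pettis_integrals : Prop :=
  forall d (T : measurableType d) (f : T -> X),
    weakly_measurable f -> bounded_set (range f) ->
    forall mu : smeasure T R, exists x, is_pettis_integral mu f x.

Definition weak_generators : set_system X :=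
  \bigcup_(phi in dual) preimage_set_system [set: X] phi measurable.

Definition weak_space : Type := g_sigma_algebraType weak_generators.

HB.instance Definition _ := Measurable.on weak_space.

Let norm_born : set_system weak_space := fun A => bounded_set (A : set X).

Let norm_bornP (A : set X) :
  norm_born A <-> exists C, forall x, A x -> `|x| <= C.
Proof.
split=> [/pinfty_ex_gt0[C _ AC]|[C AC]]; first by exists C => x /AC.
exists C; split=> [|D CD x Ax]; first exact: num_real.
by rewrite /= (le_trans (AC _ Ax))// ltW.
Qed.

Let norm_born0 : norm_born set0.
Proof. by apply/norm_bornP; exists 0 => x []. Qed.

Let norm_born_sub A B : A `<=` B -> norm_born B -> norm_born A.
Proof.
by move=> AB /norm_bornP[C BC]; apply/norm_bornP; exists C => x /AB/BC.
Qed.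

Let norm_bornU A B : norm_born A -> norm_born B -> norm_born (A `|` B).
Proof.
move=> /norm_bornP[C AC] /norm_bornP[C' BC']; apply/norm_bornP.
by exists (Num.max C C') => x [/AC|/BC'] xC; rewrite le_max xC ?orbT.
Qed.

Let norm_born1 x : norm_born [set x].
Proof. by apply/norm_bornP; exists `|x : X| => _ ->. Qed.

HB.instance Definition _ :=
  isBornological.Build weak_space norm_born0 norm_born_sub norm_bornU norm_born1.

End pettis.

(* Main.v *)
From HB Require Import structures.
Require Import Defs.
From mathcomp Require Import all_boot all_order all_algebra.
From mathcomp Require Import all_classical all_reals all_analysis.
From mathcomp Require Import measurable_realfun lra.

Set Implicit Arguments.
Unset Strict Implicit.
Unset Printing Implicit Defensive.

Import Order.TTheory GRing.Theory Num.Theory.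
Import numFieldNormedType.Exports.

Local Open Scope classical_set_scope.
Local Open Scope ring_scope.

(** The structure map sends a measure to its barycentre, and every assertion
    about a barycentre is tested against the functionals [phi] of the dual,
    where it becomes a statement about the real integrals
    [charge_integral mu phi]. Two ingredients make this work.

    The first is the theorem of Hahn and Banach in the form
    [exists_norming_functional]. It shows that the dual separates points, so
    that Pettis integrals are unique and equations between barycentres may be
    checked after applying [phi]; and it bounds the norm of a barycentre by
    the numbers [phi x], so that the structure map is bornological.

    The second is the calculus of integrals against signed measures. The
    definition through the Hahn decomposition is inconvenient because Jordan
    parts are not preserved by direct images; [charge_integral_sub] replaces
    the Jordan decomposition by any expression of the charge as a difference
    of two measures, and the change of variables formula
    [charge_integral_map] follows. For measures in [Mspace R X] and functions
    bounded on bounded sets, approximation by simple functions together with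
    dominated convergence reduces the dependence of the integral on the
    measure to the evaluations [Ev E]. This yields the measurability of
    [mu |-> charge_integral mu f] and the formula [charge_integral_Mmult] for
    the integral against the multiplication of the monad.

    The assumption on [X] concerns functions with bounded image, and the
    identity of [X] is not one of them, so existence needs an argument. A
    measure in [Mspace] comes from a signed measure on a bounded set [B], which
    in general is not weakly measurable. The function [r] that is the identity
    on [B] and zero elsewhere has bounded image and is measurable for the
    sigma-algebra that it generates; the measure on [B] induces one on that
    sigma-algebra whose direct image along [r] is the given measure, so that
    the Pettis integral of [r] is the required vector.

    Measurability, the unit law and the associativity law then come from the
    formulas for [phi] applied to a barycentre. For associativity, both sides
    are sent by [phi] to the integral of [mu |-> charge_integral mu phi]. *)

(** * Minimal sublinear functionals and the Hahn-Banach theorem *)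

Section sublinear.
Context (R : realType) (V : lmodType R).
Implicit Types (p q : V -> R) (A : set (V -> R)).

Definition sublinear p : Prop :=
  (forall x y, p (x + y) <= p x + p y) /\
  (forall t x, 0 < t -> p (t *: x) <= t * p x).

Lemma sublinear0 p : sublinear p -> p 0 = 0.
Proof.
move=> [pD pZ]; have := pD 0 0; have := pZ 2^-1 0; rewrite scaler0 addr0.
by move=> /(_ ltac:(lra)); lra.
Qed.

Lemma sublinearZ p : sublinear p -> forall t x, 0 <= t -> p (t *: x) = t * p x.
Proof.
move=> sp t x; rewrite le_eqVlt => /predU1P[<-|t0].
  by rewrite scale0r sublinear0// mul0r.
apply/eqP; rewrite eq_le sp.2//=.
have := sp.2 t^-1 (t *: x); rewrite invr_gt0 => /(_ t0).
by rewrite scalerA mulVf ?gt_eqF// scale1r mulrC ler_pdivlMr// mulrC.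
Qed.

Lemma sublinearN p x : sublinear p -> - p (- x) <= p x.
Proof. by move=> sp; have := sp.1 x (- x); rewrite subrr sublinear0//; lra. Qed.

Definition pointwise_inf A (x : V) : R := inf [set f x | f in A].

Section pointwise_inf.
Variables (A : set (V -> R)) (b : V -> R).
Hypotheses (A0 : A !=set0) (Ab : forall f, A f -> forall x, b x <= f x).

Lemma pointwise_inf_le f x : A f -> pointwise_inf A x <= f x.
Proof.
move=> Af; apply: ge_inf; last by exists f.
by exists (b x) => _ [g Ag <-]; exact: Ab.
Qed.

Lemma le_pointwise_inf y x :
  (forall f, A f -> y <= f x) -> y <= pointwise_inf A x.
Proof.
move=> yA; apply: lb_le_inf; first by have [f Af] := A0; exists (f x), f.
by move=> _ [f Af <-]; exact: yA.
Qed.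

(** Infima of sublinear functionals need not be sublinear. What is required is
    that two members of the family, evaluated at two points, be dominated by
    one member evaluated at the sum; this holds for chains, and also for
    families whose members are not themselves sublinear, such as
    [ray_shifts]. *)
Lemma pointwise_inf_sublinear :
  (forall f g x y, A f -> A g -> exists2 h, A h & h (x + y) <= f x + g y) ->
  (forall f t x, A f -> 0 < t -> exists2 h, A h & h (t *: x) <= t * f x) ->
  sublinear (pointwise_inf A).
Proof.
move=> AD AZ; split=> [x y|t x t0].
  rewrite -lerBlDl; apply: le_pointwise_inf => g Ag; rewrite lerBlDl -lerBlDr.
  apply: le_pointwise_inf => f Af; rewrite lerBlDr.
  by have [h Ah] := AD f g x y Af Ag; apply: le_trans; exact: pointwise_inf_le.
rewrite mulrC -ler_pdivrMr//; apply: le_pointwise_inf => f Af.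
rewrite ler_pdivrMr// mulrC; have [h Ah] := AZ f t x Af t0.
by apply: le_trans; exact: pointwise_inf_le.
Qed.

End pointwise_inf.

(** The infimum of this family is the largest sublinear functional below [p]
    whose value at [- y] is at most [- p y]: any such functional [p'] satisfies
    [p' x <= p' (x + t *: y) + t * p' (- y)]. *)
Definition ray_shifts p y : set (V -> R) :=
  [set f | exists2 t, 0 <= t & f = fun x => p (x + t *: y) - t * p y].

Lemma ray_shifts_sublinear p y : sublinear p ->
  [/\ sublinear (pointwise_inf (ray_shifts p y)),
      forall x, pointwise_inf (ray_shifts p y) x <= p x &
      forall x, pointwise_inf (ray_shifts p y) x <= p (x + y) - p y].
Proof.
move=> sp; pose b x := - p (- x).
have rb f : ray_shifts p y f -> forall x, b x <= f x.
  move=> [t t0 ->] x; rewrite /b; have := sp.1 (x + t *: y) (- x).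
  by rewrite addrAC subrr add0r (sublinearZ sp)//; lra.
have r0 : ray_shifts p y !=set0 by eexists; exists 0.
split=> [|x|x].
- apply: (pointwise_inf_sublinear (b := b)) => //.
  + move=> _ _ x z [t t0 ->] [s s0 ->].
    exists (fun x => p (x + (t + s) *: y) - (t + s) * p y).
      by exists (t + s) => //; rewrite addr_ge0.
    by have := sp.1 (x + t *: y) (z + s *: y); rewrite scalerDl addrACA; lra.
  + move=> _ s x [t t0 ->] s0.
    exists (fun x => p (x + (s * t) *: y) - (s * t) * p y).
      by exists (s * t) => //; rewrite mulr_ge0// ltW.
    by have := sp.2 s (x + t *: y) s0; rewrite scalerDr scalerA; lra.
- have : ray_shifts p y (fun x => p (x + 0 *: y) - 0 * p y) by exists 0.
  by move=> /(pointwise_inf_le rb x); rewrite scale0r addr0 mul0r subr0.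
- have : ray_shifts p y (fun x => p (x + 1 *: y) - 1 * p y) by exists 1.
  by move=> /(pointwise_inf_le rb x); rewrite scale1r mul1r.
Qed.

(** A chain of sublinear functionals below [q] has a pointwise infimum, since
    each of them is bounded below by [x |-> - q (- x)]. *)
Lemma minimal_sublinear q : sublinear q -> exists p,
  [/\ sublinear p, forall x, p x <= q x &
    forall p', sublinear p' -> (forall x, p' x <= p x) -> p' = p].
Proof.
move=> sq; pose S := {p : V -> R | sublinear p /\ forall x, p x <= q x}.
pose le (p p' : S) := `[< forall x, sval p' x <= sval p x >].
have [||||[p [sp pq]] pmin] := @Zorn S le.
- by move=> p; exact/asboolP.
- move=> p1 p2 p3 /asboolP p12 /asboolP p23; apply/asboolP => x.
  exact: le_trans (p12 x).
- move=> [p1 h1] [p2 h2] /asboolP/= p12 /asboolP/= p21; apply: eq_exist.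
  by apply/funext => x; apply/eqP; rewrite eq_le p12 p21.
- move=> A Atot; have [->|A0] := eqVneq A set0.
    by exists (exist _ q (conj sq (fun x => lexx (q x)))).
  have {}A0 : [set sval p | p in A] !=set0.
    by have /set0P[p Ap] := A0; exists (sval p), p.
  have Ab f : [set sval p | p in A] f -> forall x, - q (- x) <= f x.
    move=> [[p [sp pq]] _ <-] x /=; apply: le_trans (sublinearN x sp).
    by rewrite lerN2.
  have sA : sublinear (pointwise_inf [set sval p | p in A]).
    apply: (pointwise_inf_sublinear A0 Ab).
    + move=> _ _ x y [p Ap <-] [p' Ap' <-].
      have [h Ah [hp hp']] : exists2 h, A h & le p h /\ le p' h.
        have [pp|pp] := Atot _ _ Ap Ap'.
        - by exists p' => //; split=> //; exact/asboolP.
        - by exists p => //; split=> //; exact/asboolP.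
      exists (sval h); first by exists h.
      have := (svalP h).1.1 x y; move/asboolP: hp => /(_ x).
      by move/asboolP: hp' => /(_ y); lra.
    + move=> _ t x [p Ap <-] t0; exists (sval p); first by exists p.
      exact: (svalP p).1.2.
  have sAq x : pointwise_inf [set sval p | p in A] x <= q x.
    have [f [p Ap _]] := A0.
    by apply: le_trans ((svalP p).2 x); apply: (pointwise_inf_le Ab); exists p.
  exists (exist _ (pointwise_inf [set sval p | p in A]) (conj sA sAq)) => p Ap.
  apply/asboolP => x /=.
  by apply: (pointwise_inf_le Ab); exists p.
- exists p; split=> // p' sp' p'p.
  have p'q x : p' x <= q x by exact: le_trans (p'p x) (pq x).
  by have /(_ (asboolT p'p))[] := pmin (exist _ p' (conj sp' p'q)).
Qed.

(** A minimal sublinear functional is linear: it agrees with the infimum of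
    its [ray_shifts] in each direction [y], and this says
    [p x + p y <= p (x + y)]. *)
Lemma hahn_banach_sublinear q : sublinear q ->
  exists phi : {scalar V}, forall x, phi x <= q x.
Proof.
move=> /minimal_sublinear[p [sp pq pmin]].
have pD x y : p (x + y) = p x + p y.
  apply/eqP; rewrite eq_le sp.1/= -lerBrDr.
  have [sr rp rpy] := ray_shifts_sublinear y sp.
  by rewrite -{1}(pmin _ sr rp); exact: rpy.
have pN x : p (- x) = - p x.
  by apply/eqP; rewrite -addr_eq0 -pD addNr sublinear0.
have lp : linear_for *%R p.
  move=> t x y; rewrite pD; congr (_ + _).
  have [t0|t0] := leP 0 t; first exact: sublinearZ.
  rewrite -[t]opprK scaleNr pN (sublinearZ sp) ?mulNr//; lra.
pose lpm := GRing.isLinear.Build _ _ _ _ p lp.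
pose phi : {scalar V} := HB.pack p lpm.
by exists phi.
Qed.

End sublinear.

(** A linear functional below the norm may be small at [x0]; lowering the norm
    along [x0] first forces the value at [- x0] to be at most [- `|x0|]. *)
Lemma exists_norming_functional (R : realType) (X : normedModType R) (x0 : X) :
  exists2 phi : {scalar X},
    (forall x, `|phi x| <= `|x|) & phi x0 = `|x0|.
Proof.
have sn : sublinear (fun x : X => `|x|).
  split=> [x y|t x t0]; first exact: ler_normD.
  by rewrite normrZ gtr0_norm.
have [sr rp rpy] := ray_shifts_sublinear x0 sn.
have [phi phir] := hahn_banach_sublinear sr.
have phile x : phi x <= `|x| by exact: le_trans (phir x) (rp x).
have phin x : `|phi x| <= `|x|.
  by rewrite ler_norml phile andbT lerNl -raddfN -(normrN x) phile.
exists phi => //; apply/eqP; rewrite eq_le phile/=.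
have := le_trans (phir (- x0)) (rpy (- x0)).
by rewrite addNr normr0 sub0r raddfN lerN2.
Qed.

(** * Integration against a signed measure *)

Lemma integrable_le_measure d (T : measurableType d) (R : realType)
    (m1 m2 : {measure set T -> \bar R}) (f : T -> \bar R) :
  (forall E, measurable E -> (m1 E <= m2 E)%E) ->
  m2.-integrable [set: T] f -> m1.-integrable [set: T] f.
Proof.
move=> m12 /integrableP[mf foo]; apply/integrableP; split => //.
apply: le_lt_trans foo; apply: ge0_le_measure_integral => //.
exact: measurableT_comp.
Qed.

Section charge_integral_theory.
Context d (T : measurableType d) (R : realType).
Implicit Types (nu : {charge set T -> \bar R}) (f g : T -> R) (E : set T).

Local Notation pos nu := (jordan_pos (hahnPN nu)).
Local Notation neg nu := (jordan_neg (hahnPN nu)).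

Lemma jordan_posI nu E : measurable E -> pos nu E = nu (E `&` hahn_pos nu).
Proof.
by move=> mE; rewrite jordan_posE cjordan_posE /crestr0 mem_set.
Qed.

Lemma jordan_negI nu E : measurable E ->
  neg nu E = (- nu (E `&` hahn_neg nu))%E.
Proof.
by move=> mE; rewrite jordan_negE cjordan_negE /crestr0 mem_set.
Qed.

Lemma charge_integrableP nu f : charge_integrable nu f <->
  (pos nu).-integrable [set: T] (EFin \o f) /\
  (neg nu).-integrable [set: T] (EFin \o f).
Proof.
split=> [intf|[/integrableP[mf pf] /integrableP[_ nf]]].
  split; apply: integrable_le_measure intf => E mE; rewrite /charge_variation.
    by rewrite leeDl.
  by rewrite leeDr.
apply/integrableP; split => //.
rewrite (eq_measure_integral (measure_add (pos nu) (neg nu))); last first.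
  by move=> E mE _; rewrite [RHS]measure_addE.
rewrite ge0_integral_measure_add//; first exact: lte_add_pinfty.
exact: measurableT_comp.
Qed.

(** The Jordan parts are the smallest measures with difference [nu], so they
    lie below [m1] and [m2] and inherit integrability from them. The values of
    the integrals agree because [m1 + neg nu] and [m2 + pos nu] are the same
    measure. The hypothesis is an equation between sums, so that [m1] and [m2]
    may take infinite values. *)
Lemma charge_integral_sub nu (m1 m2 : {measure set T -> \bar R}) f :
  (forall E, measurable E -> (nu E + m2 E = m1 E)%E) ->
  m1.-integrable [set: T] (EFin \o f) -> m2.-integrable [set: T] (EFin \o f) ->
  charge_integrable nu f /\
  charge_integral nu f = \int[m1]_x f x - \int[m2]_x f x.
Proof.
move=> nuE i1 i2; have [[mP _] [mN _] _ _] := hahnPN nu.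
have fin E : measurable E -> nu E \is a fin_num by exact: fin_num_measure.
have ip : (pos nu).-integrable [set: T] (EFin \o f).
  apply: integrable_le_measure i1 => E mE; rewrite [leLHS]jordan_posI//.
  have mEP : measurable (E `&` hahn_pos nu) by exact: measurableI.
  apply: (@le_trans _ _ (m1 (E `&` hahn_pos nu))).
    by rewrite -nuE// leeDl.
  by apply: le_measure => //; rewrite inE.
have iN : (neg nu).-integrable [set: T] (EFin \o f).
  apply: integrable_le_measure i2 => E mE; rewrite [leLHS]jordan_negI//.
  have mEN : measurable (E `&` hahn_neg nu) by exact: measurableI.
  apply: (@le_trans _ _ (m2 (E `&` hahn_neg nu))); last first.
    by apply: le_measure => //; rewrite inE.
  by rewrite -(leeD2lE _ _ (fin _ mEN)) subee ?nuE//; exact: fin.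
split; first exact/charge_integrableP.
have mf : measurable_fun [set: T] (EFin \o f) by exact: measurable_int i1.
have : (\int[m2]_x (f x)%:E + \int[pos nu]_x (f x)%:E =
    \int[m1]_x (f x)%:E + \int[neg nu]_x (f x)%:E)%E.
  rewrite -!(integral_measure_add measurableT (f := EFin \o f))//.
  apply: eq_measure_integral => E mE _; rewrite [LHS]measure_addE.
  rewrite [RHS]measure_addE.
  have : nu E = (pos nu E - neg nu E)%E.
    by rewrite (jordan_decomp (hahnPN nu) mE) /cadd/= cscaleN1.
  rewrite -nuE// addeAC => ->; rewrite subeK 1?addeC//.
  exact: fin_num_measure.
rewrite /charge_integral /Rintegral.
move/(congr1 fine).
rewrite (fineD (integrable_fin_num measurableT i2) (integrable_fin_num _ ip))//.
rewrite (fineD (integrable_fin_num measurableT i1) (integrable_fin_num _ iN))//.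
rewrite /comp; lra.
Qed.

Lemma charge_integralD nu f g :
  charge_integrable nu f -> charge_integrable nu g ->
  charge_integral nu (fun x => f x + g x) =
  charge_integral nu f + charge_integral nu g.
Proof.
move=> /charge_integrableP[pf nf] /charge_integrableP[pg ng].
by rewrite /charge_integral !RintegralD//; lra.
Qed.

Lemma charge_integralZ nu (r : R) f : charge_integrable nu f ->
  charge_integral nu (fun x => r * f x) = r * charge_integral nu f.
Proof.
move=> /charge_integrableP[pf nf].
by rewrite /charge_integral !RintegralZl// mulrBr.
Qed.

Lemma charge_integrableZ nu (r : R) f : charge_integrable nu f ->
  charge_integrable nu (fun x => r * f x).
Proof. by move=> fi; exact: integrableZl fi. Qed.

Lemma charge_integral_sum nu (I : Type) (s : seq I) (c : I -> R)
    (f : I -> T -> R) : (forall i, charge_integrable nu (f i)) ->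
  charge_integrable nu (fun x => \sum_(i <- s) c i * f i x) /\
  charge_integral nu (fun x => \sum_(i <- s) c i * f i x) =
  \sum_(i <- s) c i * charge_integral nu (f i).
Proof.
move=> fi; elim: s => [|i s [ih1 ih2]].
  under eq_fun do rewrite big_nil; rewrite big_nil; split.
    apply/charge_integrableP; split; exact: finite_measure_integrable_cst.
  by rewrite /charge_integral !Rintegral_cst// !mul0r subrr.
under eq_fun do rewrite big_cons; rewrite big_cons; split.
  exact: (integrableD measurableT (charge_integrableZ (c i) (fi i)) ih1).
rewrite charge_integralD//; last exact: charge_integrableZ.
by rewrite charge_integralZ// ih2.
Qed.

Lemma charge_integral_indic nu E : measurable E ->
  charge_integrable nu (\1_E : T -> R) /\
  charge_integral nu (\1_E : T -> R) = fine (nu E).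
Proof.
move=> mE; split.
  by apply/charge_integrableP; split; exact: integrable_indic.
rewrite /charge_integral /Rintegral !integral_indic// !setIT.
rewrite (jordan_decomp (hahnPN nu) mE) /cadd/= cscaleN1 fineB//;
  exact: fin_num_measure.
Qed.

End charge_integral_theory.

(** The direct images of the Jordan parts of [nu] need not be mutually
    singular, hence need not be the Jordan parts of [mu], but [mu] is their
    difference. *)
Lemma charge_integral_map d1 d2 (T1 : measurableType d1)
    (T2 : measurableType d2) (R : realType) (r : T1 -> T2)
    (nu : {charge set T1 -> \bar R}) (mu : {charge set T2 -> \bar R})
    (f : T2 -> R) :
  measurable_fun [set: T1] r -> measurable_fun [set: T2] f ->
  (forall E, measurable E -> mu E = nu (r @^-1` E)) ->
  charge_integrable nu (f \o r) ->
  charge_integrable mu f /\ charge_integral mu f = charge_integral nu (f \o r).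
Proof.
move=> mr mf muE /charge_integrableP[ip iN].
have mfE : measurable_fun [set: T2] (EFin \o f) by exact/measurable_EFinP.
pose m1 := measure_function_pushforward__canonical__measure_function_Measure
  (jordan_pos (hahnPN nu)) mr.
pose m2 := measure_function_pushforward__canonical__measure_function_Measure
  (jordan_neg (hahnPN nu)) mr.
have i1 : m1.-integrable [set: T2] (EFin \o f).
  exact: (integrable_pushforward mr mfE ip measurableT).
have i2 : m2.-integrable [set: T2] (EFin \o f).
  exact: (integrable_pushforward mr mfE iN measurableT).
have muD E : measurable E -> (mu E + m2 E = m1 E)%E.
  move=> mE; have mrE : measurable (r @^-1` E).
    by rewrite -[X in measurable X]setTI; apply: (mr measurableT).
  rewrite muE// (jordan_decomp (hahnPN nu) mrE) /cadd/= cscaleN1 subeK//.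
  exact: fin_num_measure.
have [ci ->] := charge_integral_sub muD i1 i2; split => //.
rewrite /charge_integral /Rintegral.
rewrite (integral_pushforward mr mfE ip measurableT).
by rewrite (integral_pushforward mr mfE iN measurableT).
Qed.

(** * Measures supported by a set *)

Section supported_integral.
Context d (T : measurableType d) (R : realType).
Variables (D : set T) (mu : smeasure T R).
Hypothesis Dmu : supported_by D mu.

(** The set [D] may fail to be measurable, so that it cannot serve as a domain
    of integration. That [mu] lives on [D] is expressed by the Jordan parts
    vanishing on the measurable sets disjoint from [D]. *)
Lemma supported_jordan0 (U : set T) : measurable U -> U `&` D = set0 ->
  jordan_pos (hahnPN mu) U = 0%E /\ jordan_neg (hahnPN mu) U = 0%E.
Proof.
move=> mU UD; have [[mP _] [mN _] _ _] := hahnPN mu.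
have sub0 V : (U `&` V) `&` D = set0 by rewrite setIAC UD set0I.
rewrite jordan_posI// jordan_negI//.
by rewrite !(supported_by0 Dmu (measurableI _ _ mU _) (sub0 _))// oppe0.
Qed.

Lemma charge_integral_cvg (g : R) (f_ : (T -> R)^nat) (f : T -> R) :
  (forall n, measurable_fun [set: T] (f_ n)) -> measurable_fun [set: T] f ->
  (forall x, f_ ^~ x @ \oo --> f x) ->
  (forall n x, D x -> `|f_ n x| <= g) ->
  (fun n => charge_integral mu (f_ n)) @ \oo --> charge_integral mu f.
Proof.
move=> mf_ mf cf bf; apply: cvgB.
- by have [] := Rintegral_cvg_off_null
    (fun U mU UD => (supported_jordan0 mU UD).1) mf_ mf cf bf.
- by have [] := Rintegral_cvg_off_null
    (fun U mU UD => (supported_jordan0 mU UD).2) mf_ mf cf bf.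
Qed.

Lemma supported_charge_integrable (g : R) (f : T -> R) :
  measurable_fun [set: T] f -> (forall x, D x -> `|f x| <= g) ->
  charge_integrable mu f.
Proof.
move=> mf fg; apply/charge_integrableP; split.
  apply: integrable_off_null mf fg => U mU UD.
  exact: (supported_jordan0 mU UD).1.
apply: integrable_off_null mf fg => U mU UD.
exact: (supported_jordan0 mU UD).2.
Qed.

Let Rintegral_le (m : {finite_measure set T -> \bar R}) (g : R) (f : T -> R) :
  (forall U, measurable U -> U `&` D = set0 -> m U = 0%E) -> 0 <= g ->
  measurable_fun [set: T] f -> (forall x, D x -> `|f x| <= g) ->
  `|\int[m]_x f x| <= g * fine (m setT).
Proof.
move=> mD g0 mf fg; have fi := integrable_off_null mD mf fg.
rewrite (le_trans (le_normr_Rintegral measurableT fi))// -Rintegral_cst//.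
have mnf : measurable_fun [set: T] (fun x => `|f x|).
  exact: measurableT_comp.
rewrite fine_le//.
- apply: (integrable_fin_num measurableT).
  by apply: (integrable_off_null mD (g := g)) => // x Dx; rewrite normr_id fg.
- apply: (integrable_fin_num measurableT).
  exact: (finite_measure_integrable_cst m g measurableT).
apply: ae_ge0_le_integral => //; first exact/measurable_EFinP.
(* The inequality can only be violated on this set, which avoids [D]. *)
have mU : measurable ((fun x => `|f x|) @^-1` `]g, +oo[%classic).
  by rewrite -[X in measurable X]setTI; apply: mnf => //; exact: measurable_itv.
exists ((fun x => `|f x|) @^-1` `]g, +oo[%classic); split => //.
  apply: mD => //; rewrite -subset0 => x [/=].
  by rewrite in_itv/= andbT ltNge => /negP fgx /fg.
move=> x /= H; rewrite in_itv/= andbT ltNge; apply/negP => fgx.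
by apply: H => _; rewrite lee_fin.
Qed.

Lemma charge_integral_le (g : R) (f : T -> R) : 0 <= g ->
  measurable_fun [set: T] f -> (forall x, D x -> `|f x| <= g) ->
  `|charge_integral mu f| <= g * tv_norm mu.
Proof.
move=> g0 mf fg; have -> : tv_norm mu =
    fine (jordan_pos (hahnPN mu) setT) + fine (jordan_neg (hahnPN mu) setT).
  by apply: EFin_inj; rewrite tv_normE EFinD !fineK// fin_num_measure.
rewrite mulrDr (le_trans (ler_normB _ _))// lerD// Rintegral_le//.
- by move=> U mU UD; exact: (supported_jordan0 mU UD).1.
- by move=> U mU UD; exact: (supported_jordan0 mU UD).2.
Qed.

End supported_integral.

Import HBSimple HBNNSimple.

(** Approximating the positive and the negative part separately from below
    gives a sequence bounded by [`|f|] itself, hence one that is dominated on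
    each bounded set as soon as [f] is bounded there. *)
Lemma simple_approximation d (T : measurableType d) (R : realType)
    (f : T -> R) : measurable_fun [set: T] f ->
  exists (s : nat -> seq R) (E : nat -> R -> set T),
    [/\ forall n y, measurable (E n y),
        forall x, (fun n => \sum_(y <- s n) y * \1_(E n y) x) @ \oo --> f x &
        forall n x, `|\sum_(y <- s n) y * \1_(E n y) x| <= `|f x| ].
Proof.
move=> mf; have mfp : measurable_fun [set: T] (EFin \o f^\+).
  exact/measurable_EFinP/measurable_funrpos.
have mfn : measurable_fun [set: T] (EFin \o f^\-).
  exact/measurable_EFinP/measurable_funrneg.
pose p := nnsfun_approx measurableT mfp.
pose q := nnsfun_approx measurableT mfn.
have p0 x : [set: T] x -> (0%:E <= (EFin \o f^\+)%R x)%E.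
  by move=> _; rewrite lee_fin funrpos_ge0.
have q0 x : [set: T] x -> (0%:E <= (EFin \o f^\-)%R x)%E.
  by move=> _; rewrite lee_fin funrneg_ge0.
pose g n : {sfun T >-> R} := (p n : {sfun T >-> R}) - (q n : {sfun T >-> R}).
pose s n : seq R := finmap.enum_fset (fset_set (range (g n))).
have gE n x : \sum_(y <- s n) y * \1_(g n @^-1` [set y]) x =
    p n x - q n x.
  by rewrite -fsbig_finite//= -fimfunE.
exists s, (fun n y => g n @^-1` [set y]).
split.
- by [].
- move=> x; under eq_fun do rewrite gE.
  have -> : f x = f^\+ x - f^\- x by rewrite -[in LHS](funrposBneg f).
  apply: cvgB.
    have /fine_cvg := cvg_nnsfun_approx measurableT mfp p0 (x := x) Logic.I.
    by [].
  have /fine_cvg := cvg_nnsfun_approx measurableT mfn q0 (x := x) Logic.I.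
  by [].
- move=> n x; rewrite gE.
  have -> : `|f x| = f^\+ x + f^\- x.
    by have /(congr1 (fun h => h x)) := funrposDneg f.
  have pl : p n x <= f^\+ x.
    by rewrite -lee_fin /p nnsfun_approxE; exact: le_approx.
  have ql : q n x <= f^\- x.
    by rewrite -lee_fin /q nnsfun_approxE; exact: le_approx.
  rewrite (le_trans (ler_normB _ _))// lerD//.
    by rewrite ger0_norm.
  by rewrite ger0_norm.
Qed.

(** * Integrals over the monad *)

Definition bounded_on_born (R : realType) d (X : bornMeasType d)
    (f : X -> R) : Prop :=
  forall B, born B -> exists2 g : R, 0 <= g & forall x, B x -> `|f x| <= g.

Section Mspace_integral.
Context (R : realType) d (X : bornMeasType d).
Implicit Types (f : X -> R) (mu : Mspace R X).

Lemma Mspace_integrable f mu : measurable_fun [set: X] f ->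
  bounded_on_born f -> charge_integrable mu f.
Proof.
move=> mf bf; have [B bB sB] := Mspace_supported mu.
by have [g g0 fg] := bf B bB; exact: (supported_charge_integrable sB mf fg).
Qed.

Lemma Mspace_simple_integral (s : seq R) (E : R -> set X) mu :
  (forall y, measurable (E y)) ->
  charge_integral mu (fun x => \sum_(y <- s) y * \1_(E y) x) =
  \sum_(y <- s) y * Ev (E y) mu.
Proof.
move=> mE; have ci y := charge_integral_indic mu (mE y).
rewrite (charge_integral_sum (nu := mu) s id (fun y => (ci y).1)).2.
by apply: eq_bigr => y _; rewrite (ci y).2.
Qed.

(** One sequence of linear combinations of evaluations computes the integral of
    [f] against all the measures in [Mspace R X] at once, although these have no
    common bounded support. *)
Lemma Mspace_integral_approximation f :
  measurable_fun [set: X] f -> bounded_on_born f ->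
  exists (s : nat -> seq R) (E : nat -> R -> set X),
    [/\ forall n y, measurable (E n y),
        forall mu, (fun n => \sum_(y <- s n) y * Ev (E n y) mu) @ \oo -->
                   charge_integral mu f &
        forall B (g : R) mu, supported_by B mu -> 0 <= g ->
          (forall x, B x -> `|f x| <= g) -> forall n,
          `|\sum_(y <- s n) y * Ev (E n y) mu| <= g * tv_norm mu].
Proof.
move=> mf bf; have [s [E [mE cE bE]]] := simple_approximation mf.
have ms n : measurable_fun [set: X] (fun x => \sum_(y <- s n) y * \1_(E n y) x).
  apply: measurable_sum => y; exact: measurable_funM.
exists s, E; split => // [mu|B g mu sB g0 fg n].
- under eq_fun do rewrite -Mspace_simple_integral//.
  have [B bB sB] := Mspace_supported mu; have [g g0 fg] := bf B bB.
  apply: (charge_integral_cvg sB (g := g)) => // n x Bx.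
  exact: le_trans (bE n x) (fg x Bx).
- rewrite -Mspace_simple_integral//; apply: (charge_integral_le sB) => // x Bx.
  exact: le_trans (bE n x) (fg x Bx).
Qed.

Lemma measurable_Mspace_integral f :
  measurable_fun [set: X] f -> bounded_on_born f ->
  measurable_fun [set: Mspace R X]
    (fun mu : Mspace R X => charge_integral mu f).
Proof.
move=> mf bf; have [s [E [mE cE _]]] := Mspace_integral_approximation mf bf.
apply: (measurable_fun_cvg
  (h := fun n (mu : Mspace R X) => \sum_(y <- s n) y * Ev (E n y) mu)).
  move=> n; apply: measurable_sum => y; apply: measurable_funM => //.
  exact: measurable_Ev.
by move=> mu _; exact: cE.
Qed.

(** For an indicator function this is the definition of [Mmult]. The general
    case passes to the limit on both sides; the bound on the right comes from
    the bounded set of measures that supports [M], whose members have a common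
    bounded support and bounded total variation. *)
Lemma charge_integral_Mmult (M : Mspace R (Mspace R X)) f :
  measurable_fun [set: X] f -> bounded_on_born f ->
  charge_integral (Mmult M) f =
  charge_integral M (fun mu : Mspace R X => charge_integral mu f).
Proof.
move=> mf bf; have [s [E [mE cE bE]]] := Mspace_integral_approximation mf bf.
have [D [B [g [bB g0 DB]]] sD] := Mspace_supported M.
have [k k0 fk] := bf B bB.
have iE n y : charge_integrable M (fun mu : Mspace R X => Ev (E n y) mu).
  apply: (supported_charge_integrable sD (g := g)); first exact: measurable_Ev.
  by move=> mu /DB[_]; apply: le_trans; exact: Ev_le.
have := cE (Mmult M); under eq_fun => n.
  rewrite (_ : \sum_(y <- s n) _ = charge_integral M
    (fun mu : Mspace R X => \sum_(y <- s n) y * Ev (E n y) mu)); last first.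
    rewrite (charge_integral_sum (nu := M) (s n) id (iE n)).2.
    by apply: eq_bigr => y _; rewrite /Ev MmultE.
  over.
move=> c1; apply: (cvg_unique (@norm_hausdorff _ _) c1).
apply: (charge_integral_cvg sD (g := k * g)).
- move=> n; apply: measurable_sum => y; apply: measurable_funM => //.
  exact: measurable_Ev.
- exact: measurable_Mspace_integral.
- exact: cE.
- move=> n mu /DB[sB mug]; apply: le_trans (bE _ _ _ sB k0 fk n) _.
  by rewrite ler_wpM2l.
Qed.

End Mspace_integral.

(** * The dual of a normed space and its weak sigma-algebra *)

Section dual_weak_space.
Context (R : realType) (X : normedModType R).

Lemma measurable_dual (phi : {scalar X}) : dual phi ->
  measurable_fun [set: weak_space X] (phi : weak_space X -> R).
Proof.
move=> dphi _ A mA; apply: sub_gen_smallest.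
by exists phi => //; exists A.
Qed.

Lemma weak_bornP (B : set (weak_space X)) :
  born B <-> exists2 C, 0 <= C & forall x : X, B x -> `|x| <= C.
Proof.
split=> [/pinfty_ex_gt0[C C0 BC]|[C C0 BC]].
  by exists C => [|x /BC//]; exact: ltW.
exists C; split=> [|D CD x Bx]; first exact: num_real.
by rewrite /= (le_trans (BC _ Bx))// ltW.
Qed.

Lemma dual_bounded_on_born (phi : {scalar X}) : dual phi ->
  bounded_on_born (phi : weak_space X -> R).
Proof.
move=> [C phiC] B /weak_bornP[K K0 BK]; exists (`|C| * K).
  by rewrite mulr_ge0.
move=> x Bx; rewrite (le_trans (phiC x))// (@le_trans _ _ (`|C| * `|x : X|))//.
  by rewrite ler_wpM2r// ler_norm.
by rewrite ler_wpM2l// BK.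
Qed.

Lemma dual_norming (x0 : X) : exists phi : {scalar X},
  [/\ dual phi, forall x, `|phi x| <= `|x| & phi x0 = `|x0| ].
Proof.
have [phi phi1 phix] := exists_norming_functional x0.
by exists phi; split => //; exists 1 => x; rewrite mul1r.
Qed.

Lemma dual_separates (x y : X) :
  (forall phi, dual phi -> phi x = phi y) -> x = y.
Proof.
move=> xy; apply/eqP; rewrite -subr_eq0 -normr_eq0.
by have [phi [dphi _ <-]] := dual_norming (x - y); rewrite raddfB /= xy// subrr.
Qed.

Lemma pettis_unique d (T : measurableType d) (mu : smeasure T R) (f : T -> X)
    (x y : X) :
  is_pettis_integral mu f x -> is_pettis_integral mu f y -> x = y.
Proof.
move=> px py; apply: dual_separates => phi dphi.
by rewrite (px phi dphi).2 (py phi dphi).2.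
Qed.

End dual_weak_space.

(** * Existence of barycentres *)

Section existence.
Context (R : realType) (X : normedModType R).
Variable B : set (weak_space X).

Let r (x : weak_space X) : weak_space X := if `[< B x >] then x else (0 : X).

Local Notation T := (g_sigma_algebra_preimageType r).

Variable (nu0 : set B -> \bar R).
Hypothesis nu0P : is_signed_measure (@trace_sigma _ (weak_space X) B) nu0.

(** A set in the sigma-algebra generated by [r] has a measurable trace on [B],
    because [r] is the identity there. *)
Definition trace_charge (F : set T) : \bar R := nu0 (set_val @^-1` F).

Let r_val (b : B) : r (set_val b) = set_val b.
Proof. by rewrite /r asboolT//; exact: set_valP. Qed.

Let trace_r (F : set T) : measurable F ->
  @trace_sigma _ (weak_space X) B (set_val @^-1` F).
Proof.
move=> [E mE <-]; exists E => //; rewrite !setTI.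
by apply/seteqP; split => b; rewrite /preimage/= r_val.
Qed.

Let nu00 : trace_charge set0 = 0%E.
Proof. by rewrite /trace_charge preimage_set0; case: nu0P. Qed.

Let nu0_fin F : measurable F -> trace_charge F \is a fin_num.
Proof. by move=> mF; case: nu0P => _ + _; apply; exact: trace_r. Qed.

Let nu0_sigma : semi_sigma_additive trace_charge.
Proof.
move=> F mF tF mUF; rewrite /trace_charge preimage_bigcup.
case: nu0P => _ _; apply; first by move=> n; exact: trace_r.
apply/trivIsetP => i j _ _ ij; rewrite -preimage_setI.
by move/trivIsetP : tF => /(_ i j Logic.I Logic.I ij) ->; rewrite preimage_set0.
Qed.

HB.instance Definition _ := isCharge.Build _ T R trace_charge
  nu00 nu0_fin nu0_sigma.

(** The direct image of [trace_charge] along [r] is [mu], and the image of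
    [r] lies in the bounded set [B] with zero added. *)
Lemma pettis_integral_supported (mu : smeasure (weak_space X) R) :
  enough_pettis_integrals X -> born B ->
  (forall E, measurable E -> mu E = nu0 (set_val @^-1` E)) ->
  exists x, is_pettis_integral mu (fun y : weak_space X => y : X) x.
Proof.
move=> hX bB muE.
have mr : measurable_fun [set: T] (r : T -> weak_space X).
  by move=> _ E mE; exists E.
have wr : weakly_measurable (fun t : T => r t : X).
  by move=> phi dphi; exact: (measurableT_comp (measurable_dual dphi) mr).
have br : bounded_set (range (fun t : T => r t : X)).
  suff : born (range r : set (weak_space X)) by [].
  move/weak_bornP: bB => [C C0 BC]; apply/weak_bornP.
  exists C => // _ [y _ <-]; rewrite /r.
  by case: asboolP => [/BC//|_]; rewrite normr0.
pose nu : {charge set T -> \bar R} := trace_charge.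
have [x px] := hX _ _ _ wr br (smeasure_of nu).
exists x => phi dphi; have [iphi xphi] := px phi dphi.
have mphi := measurable_dual dphi.
have [|ci ciE] := charge_integral_map (mu := mu) mr mphi _ iphi.
  move=> E mE; rewrite smeasure_ofE; last by exists E => //; rewrite setTI.
  rewrite muE// /trace_charge; congr nu0.
  by apply/seteqP; split => b; rewrite /preimage/= r_val.
by split; rewrite // xphi ciE.
Qed.

End existence.

Lemma pettis_integral_Mspace (R : realType) (X : normedModType R)
    (mu : Mspace R (weak_space X)) : enough_pettis_integrals X ->
  exists x, is_pettis_integral mu (fun y : weak_space X => y : X) x.
Proof.
move=> hX; have [B bB sB] := Mspace_supported mu.
have [nu0 nu0P muE] := sB.
exact: (pettis_integral_supported nu0P hX bB muE).
Qed.

(** * The algebra structure *)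

Section barycentre.
Context (R : realType) (X : normedModType R).
Hypothesis hX : enough_pettis_integrals X.
Local Notation W := (weak_space X).
Implicit Types mu : Mspace R W.

Definition barycentre mu : W := sval (cid (pettis_integral_Mspace mu hX)).

Lemma barycentreP mu :
  is_pettis_integral mu (fun y : W => y : X) (barycentre mu).
Proof. exact: svalP (cid (pettis_integral_Mspace mu hX)). Qed.

Lemma barycentreE mu (x : X) :
  (forall phi : {scalar X}, dual phi -> phi x = charge_integral mu phi) ->
  barycentre mu = x.
Proof.
move=> xE; apply: (@dual_separates _ X) => phi dphi.
by rewrite xE// (barycentreP mu dphi).2.
Qed.

(** The weak sigma-algebra is generated by the functionals [phi], and
    [phi] composed with [barycentre] is integration of [phi]. Boundedness uses
    a functional that attains the norm of the barycentre. *)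
Lemma barycentre_morphism : bornMeas_morphism barycentre.
Proof.
split.
  apply: (@measurability _ _ _ W _ _ (@weak_generators R X)) => //.
  move=> _ [_ [phi dphi [A mA <-]] <-]; rewrite setTI setTI.
  have -> : barycentre @^-1` (phi @^-1` A) =
      (fun mu : Mspace R W => charge_integral mu phi) @^-1` A.
    by apply/seteqP; split => mu; rewrite /preimage/= (barycentreP mu dphi).2.
  rewrite -[X in measurable X]setTI.
  apply: (measurable_Mspace_integral (measurable_dual dphi)) => //.
  exact: dual_bounded_on_born.
move=> A [B [g [/weak_bornP[C C0 BC] g0 AB]]]; apply/weak_bornP.
exists (C * g); first exact: mulr_ge0.
move=> _ [mu /AB[sB mug] <-].
have [phi [dphi phi1 <-]] := dual_norming (barycentre mu : X).
rewrite (barycentreP mu dphi).2 (le_trans (ler_norm _))//.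
apply: (@le_trans _ _ (C * tv_norm mu)); last by rewrite ler_wpM2l.
apply: (charge_integral_le sB C0 (measurable_dual dphi)) => x Bx.
exact: le_trans (phi1 x) (BC x Bx).
Qed.

Lemma barycentre_unit : barycentre \o Munit R = id.
Proof.
apply/funext => x /=; apply: barycentreE => phi dphi.
have mphi := measurable_dual dphi.
have mphiE : measurable_fun [set: W] (EFin \o (phi : W -> R)).
  exact/measurable_EFinP.
have id1 : (\d_x : {measure set W -> \bar R}).-integrable [set: W]
    (EFin \o (phi : W -> R)).
  apply/integrableP; split => //.
  rewrite integral_dirac//; last exact: measurableT_comp.
  by rewrite diracT mul1e ltry.
have iz : (mzero : {measure set W -> \bar R}).-integrable [set: W]
    (EFin \o (phi : W -> R)).
  by apply/integrableP; split => //; rewrite integral_measure_zero.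
have [] := charge_integral_sub (nu := Munit R x) _ id1 iz.
  by move=> E mE; rewrite [Munit R x E]smeasure_ofE// adde0.
move=> _ ->; rewrite /Rintegral integral_measure_zero integral_dirac//.
by rewrite diracT mul1e subr0.
Qed.

Lemma barycentre_assoc :
  barycentre \o Mfun barycentre_morphism = barycentre \o @Mmult R _ W.
Proof.
apply/funext => M /=; apply/esym/barycentreE => phi dphi.
have mphi := measurable_dual dphi; have bphi := dual_bounded_on_born dphi.
rewrite charge_integral_Mmult// (barycentreP _ dphi).2.
have E1 : (phi : W -> R) \o barycentre =
    (fun mu : Mspace R W => charge_integral mu phi).
  by apply/funext => mu /=; rewrite (barycentreP mu dphi).2.
have [] := charge_integral_map (nu := M) (mu := Mfun barycentre_morphism M)
  (f := phi : W -> R) barycentre_morphism.1 mphi.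
- by move=> E mE; rewrite [LHS]smeasure_mapE.
- apply: Mspace_integrable.
    exact: (measurableT_comp mphi barycentre_morphism.1).
  move=> B /barycentre_morphism.2 /bphi[g g0 Bg]; exists g => // x Bx.
  by apply: Bg; exists x.
by move=> _ ->; rewrite E1.
Qed.

End barycentre.

Theorem theorem13p6 (R : realType) (X : completeNormedModType R)
    (hX : enough_pettis_integrals X) :
  exists c : Mspace R (weak_space X) -> weak_space X,
    (forall (mu : Mspace R (weak_space X)) (x : X),
      is_pettis_integral mu (fun y : weak_space X => y : X) x <-> x = c mu) /\
    is_Malgebra c.
Proof.
exists (barycentre hX); split=> [mu x|].
  by split=> [px|->]; [exact: pettis_unique px (barycentreP hX mu)
                      |exact: barycentreP].
exact: IsMalgebra (barycentre_unit hX) (barycentre_assoc hX).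
Qed.
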